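(* If $(x_n)_{n\ge0}$ is a square computable sequence of real numbers and $(\phi_n)_{n\ge0}$ is a computable sequence of real numbers, then for each $\alpha\in KC$ the series $$\sum_{n=0}^{\infty}\varepsilon_n(\alpha)\,x_n\cos(2\pi nt+\phi_n)$$ converges at each computable number $t\in[0,1]$.
   Context: Write $\mathcal{N}=\{-1,1\}^{\omega}$ for the space of infinite sequences of $\pm1$. For $\alpha\in\mathcal{N}$ let $\overline{\alpha}(n)$ be its initial segment of length $n$. $K$ denotes (prefix-free, i.e. self-delimiting) Kolmogorov complexity of finite strings. A sequence $\alpha\in\mathcal{N}$ is Kolmogorov-Chaitin complex if there is $k$ such that $K(\overline{\alpha}(n))\ge n-k$ for all $n$; the set of such $\alpha$ is denoted $KC$. For $\alpha\in KC$, $\varepsilon_n(\alpha)\in\{-1,1\}$ denotes the $n$th bit of $\alpha$. A sequence $(x_n)$ of real numbers is a computable sequence if there is an effective way of approximating $x_n$ arbitrarily closely, given $n$. A computable sequence of real numbers $(x_n)$ is square computable if there is an effective procedure for determining the sum $\sum_{k}x_k^2$ to arbitrary accuracy from $(x_n)$; that is, given a positive integer $m$, there is an effective procedure for finding $n=n(m)$ such that $\left|\sum_{k}x_k^2-\sum_{k\le n}x_k^2\right|<1/m$ (in particular the infinite sum is finite). *)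

(* Defs.v *)
From HB Require Import structures.
From mathcomp Require Import all_boot all_order all_algebra.
From mathcomp Require Import all_classical all_reals all_analysis.
Set Implicit Arguments.
Unset Strict Implicit.
Unset Printing Implicit Defensive.
Import Order.TTheory GRing.Theory Num.Theory.
Import numFieldNormedType.Exports.
Local Open Scope classical_set_scope.
Local Open Scope ring_scope.

(** * Partial recursive functions *)

(** Partial functions are given by their graphs: [f v y] means that [f] is
    defined at [v] with value [y]. *)
Definition pfun (k : nat) := k.-tuple nat -> nat -> Prop.

Definition pzero (k : nat) : pfun k := fun _ y => y = 0%N.

Definition psucc : pfun 1 := fun v y => y = (thead v).+1.

Definition pproj (k : nat) (i : 'I_k) : pfun k := fun v y => y = tnth v i.

Definition pcomp (k m : nat) (f : pfun m) (g : 'I_m -> pfun k) : pfun k :=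
  fun v y => exists w : m.-tuple nat, (forall i, g i v (tnth w i)) /\ f w y.

(** [h (0, v) = f v] and [h (i + 1, v) = g (i, h (i, v), v)]; the witness [s]
    lists the successive values [h (i, v)]. *)
Definition pprec (k : nat) (f : pfun k) (g : pfun k.+2) : pfun k.+1 :=
  fun v y => exists s : nat -> nat,
    [/\ f [tuple of behead v] (s 0%N),
        forall i, (i < thead v)%N ->
          g [tuple of i :: s i :: behead v] (s i.+1)
      & y = s (thead v)].

(** The value is the least [y] with [f (y, v) = 0], all previous values of
    [f] being required to be defined. *)
Definition pmu (k : nat) (f : pfun k.+1) : pfun k :=
  fun v y => f [tuple of y :: v] 0%N /\
    forall i, (i < y)%N -> exists z, f [tuple of i :: v] z.+1.

Inductive partial_recursive : forall k : nat, pfun k -> Prop :=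
| pr_zero k : partial_recursive (@pzero k)
| pr_succ : partial_recursive psucc
| pr_proj k (i : 'I_k) : partial_recursive (pproj i)
| pr_comp k m (f : pfun m) (g : 'I_m -> pfun k) :
    partial_recursive f -> (forall i, partial_recursive (g i)) ->
    partial_recursive (pcomp f g)
| pr_prec k (f : pfun k) (g : pfun k.+2) :
    partial_recursive f -> partial_recursive g ->
    partial_recursive (pprec f g)
| pr_mu k (f : pfun k.+1) :
    partial_recursive f -> partial_recursive (pmu f).

Definition computable1 (f : nat -> nat) : Prop :=
  partial_recursive (fun (v : 1.-tuple nat) y => y = f (thead v)).

Definition computable2 (f : nat -> nat -> nat) : Prop :=
  partial_recursive
    (fun (v : 2.-tuple nat) y => y = f (thead v) (thead (behead_tuple v))).

(** * Prefix-free Kolmogorov complexity *)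

(** Bijective base-2 numeration, a bijection from binary strings to [nat]. *)
Fixpoint string_code (s : seq bool) : nat :=
  if s is b :: s' then ((string_code s').*2 + b).+1 else 0.

(** [M p s] means that the machine [M] halts on program [p] and outputs [s]. *)
Definition machine := seq bool -> seq bool -> Prop.

Definition computable_machine (M : machine) : Prop :=
  exists2 F : pfun 1, partial_recursive F &
    forall p s, M p s <-> F [tuple string_code p] (string_code s).

Definition prefix_free (M : machine) : Prop :=
  forall p q s s', M p s -> M q s' -> prefix p q -> p = q.

Definition prefix_free_machine (M : machine) : Prop :=
  computable_machine M /\ prefix_free M.

Definition optimal_machine (U : machine) : Prop :=
  prefix_free_machine U /\
  forall M, prefix_free_machine M ->
    exists c : nat, forall p s, M p s ->
      exists2 q, U q s & (size q <= size p + c)%N.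

Definition has_program (U : machine) (s : seq bool) (n : nat) : bool :=
  `[< exists2 p, U p s & size p = n >].

(** The length of a shortest program for [s]. The default value [0] is never
    used when [U] is optimal, since then every string has a program. *)
Definition K (U : machine) (s : seq bool) : nat :=
  if pselect (exists n, has_program U s n) is left ex then ex_minn ex else 0%N.

(** An element of $\{-1,1\}^\omega$ is encoded by [alpha : nat -> bool], with
    [true] standing for 1 and [false] for -1; see [epsilon]. *)
Definition KC (U : machine) : set (nat -> bool) :=
  [set alpha | exists k : nat, forall n : nat,
    (n - k <= K U (mkseq alpha n))%N].

Definition epsilon (R : realType) (n : nat) (alpha : nat -> bool) : R :=
  if alpha n then 1 else -1.

(** * Computable reals *)

(** A computable double sequence of rationals
    [(-1) ^ s(n,k) * p(n,k) / q(n,k)] approximates [x n] within [2 ^ -k]. *)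
Definition computable_seq (R : realType) (x : nat -> R) : Prop :=
  exists s p q : nat -> nat -> nat,
    [/\ computable2 s, computable2 p, computable2 q,
        forall n k, q n k != 0%N
      & forall n k,
          `|x n - (-1) ^+ s n k * (p n k)%:R / (q n k)%:R| <= 2 ^- k].

Definition computable_real (R : realType) (t : R) : Prop :=
  computable_seq (fun _ : nat => t).

Definition square_computable (R : realType) (x : nat -> R) : Prop :=
  [/\ computable_seq x,
      cvgn (series (fun k => x k ^+ 2))
    & exists2 N : nat -> nat, computable1 N &
        forall m : nat, (0 < m)%N ->
          `|limn (series (fun k => x k ^+ 2))
            - \sum_(0 <= k < (N m).+1) x k ^+ 2| < m%:R^-1].

(* Main.v *)
Require Import Defs.
From HB Require Import structures.
From mathcomp Require Import all_boot all_order all_algebra.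
From mathcomp Require Import all_classical all_reals all_analysis.
From mathcomp Require Import zify ring lra.
Set Implicit Arguments.
Unset Strict Implicit.
Unset Printing Implicit Defensive.
Import Order.TTheory GRing.Theory Num.Theory.
Import numFieldNormedType.Exports.
Local Open Scope classical_set_scope.
Local Open Scope ring_scope.

(** A sequence in [KC] escapes every null set that can be covered effectively,
    and the divergence of the series is contained in such a null set.

    The coefficients [a n = x n * cos (2 * pi * n%:R * t + phi n)] form a
    computable sequence.  Replacing them by dyadic rationals at distance at most
    [2 * 2 ^- n] changes the series by an absolutely convergent one
    ([cvgn_series_approx]), and makes it decidable whether a signed partial sum
    is large.  From the modulus of convergence of the sum of the [x k ^+ 2] one
    computes times [n 0 < n 1 < ...] such that the squares of the steps from
    [n j] on add up to at most [2 ^- (5 * j)].  Kolmogorov's maximal inequality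
    ([kolmogorov_inequality]) then shows that, of the strings of signs of length
    [L = n j.+1], at most [2 ^ (L - 3 * j)] are exceptional, that is, let the
    signed sum move by [2 ^- j] or more after time [n j] ([rank_exceptional]).

    An exceptional string can be recovered from [j] and from its rank among the
    exceptional strings of its length.  Writing [j] in unary and the rank with
    [L - 3 * j] bits gives a prefix-free machine with programs of length
    [L - 2 * j + 1] ([enumerative_coding]).  If the initial segment of length [L]
    of [alpha] were exceptional for arbitrarily large [j], its complexity could
    not stay above [L - k] for a fixed [k] ([KC_not_exceptional]).  Hence from
    some [j] on the partial sums move by at most [2 ^- j] between [n j] and
    [n j.+1], and they form a Cauchy sequence ([cvgn_of_blocks]).

    That the dyadic coefficients are recursive is seen by giving them by closed
    arithmetical expressions: computable functions are closed under the usual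
    operations and under bounded sums, the cosine is approximated by its Taylor
    polynomials and [pi] by Leibniz's series, each over a common denominator. *)

(** * Total computable functions of an environment *)

Section TotalComputable.
Local Open Scope nat_scope.

(** The arguments are the first [k] entries of an environment, read with
    [nth 0], so that a function of several variables can be written as an
    ordinary expression and a bounded variable is pushed in front of the list. *)
Definition computable_fun (k : nat) (f : seq nat -> nat) : Prop :=
  partial_recursive (fun (v : k.-tuple nat) y => y = f v).

Lemma eq_computable_fun k (f g : seq nat -> nat) :
  (forall v, size v = k -> f v = g v) -> computable_fun k f ->
  computable_fun k g.
Proof.
rewrite /computable_fun => fg; congr partial_recursive.
apply/funext => v; apply/funext => y.
by rewrite fg ?size_tuple.
Qed.

Lemma computable_var k i : i < k -> computable_fun k (fun v => nth 0 v i).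
Proof.
move=> ik; have := pr_proj (Ordinal ik); congr partial_recursive.
apply/funext => v; apply/funext => y.
by rewrite /pproj (tnth_nth 0).
Qed.

Lemma computable_comp k m (f : seq nat -> nat) (g : nat -> seq nat -> nat) :
  computable_fun m f -> (forall i, i < m -> computable_fun k (g i)) ->
  computable_fun k (fun v => f (mkseq (g ^~ v) m)).
Proof.
move=> cf cg.
have := pr_comp (g := fun i : 'I_m => fun v y => y = g i v) cf
  (fun i => cg i (ltn_ord i)).
congr partial_recursive; apply/funext => v; apply/funext => y.
apply/propext; split => [[w [wg ->]]|->].
  congr f; apply: (@eq_from_nth _ 0); first by rewrite size_mkseq size_tuple.
  move=> i; rewrite size_tuple => im.
  by rewrite nth_mkseq// -(wg (Ordinal im)) (tnth_nth 0).
exists [tuple of mkseq (g ^~ v) m]; split => // i.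
by rewrite (tnth_nth 0)/= nth_mkseq.
Qed.

Lemma computable_succ k f :
  computable_fun k f -> computable_fun k (fun v => (f v).+1).
Proof.
move=> cf; apply: (@computable_comp k 1 (fun v => (nth 0 v 0).+1)
  (fun=> f)) => //.
have := pr_succ; congr partial_recursive; apply/funext => v.
by apply/funext => y; rewrite /psucc; case/tupleP: v => a v; rewrite theadE.
Qed.

Lemma computable_const k c : computable_fun k (fun=> c).
Proof.
elim: c => [|c IH]; last exact: computable_succ.
have := pr_zero k; congr partial_recursive.
Qed.

Lemma computable1_fun k h f :
  computable1 h -> computable_fun k f -> computable_fun k (fun v => h (f v)).
Proof.
move=> ch cf; apply: (@computable_comp k 1 (fun v => h (nth 0 v 0))
  (fun=> f)) => //.
move: ch; congr partial_recursive; apply/funext => v.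
by apply/funext => y; case/tupleP: v => a v; rewrite theadE.
Qed.

Lemma computable2_fun k h f g :
  computable2 h -> computable_fun k f -> computable_fun k g ->
  computable_fun k (fun v => h (f v) (g v)).
Proof.
move=> ch cf cg; apply: (@computable_comp k 2
  (fun v => h (nth 0 v 0) (nth 0 v 1)) (fun i => if i is 0 then f else g)).
  move: ch; congr partial_recursive; apply/funext => v; apply/funext => y.
  by rewrite /thead !(tnth_nth 0) /= nth_behead.
by case=> [|[|//]] _.
Qed.

Lemma computable1P h : computable_fun 1 (fun v => h (nth 0 v 0)) ->
  computable1 h.
Proof.
congr partial_recursive; apply/funext => v.
by apply/funext => y; case/tupleP: v => a v; rewrite theadE.
Qed.

Lemma computable2P h :
  computable_fun 2 (fun v => h (nth 0 v 0) (nth 0 v 1)) -> computable2 h.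
Proof.
congr partial_recursive; apply/funext => v; apply/funext => y.
by rewrite /thead !(tnth_nth 0) /= nth_behead.
Qed.

(** Primitive recursion with a recursion bound and a base value that are
    themselves functions of the environment; in the step function, the counter
    and the previous value are the two first variables. *)
Lemma computable_rec k (n f : seq nat -> nat) (g : nat -> nat -> seq nat -> nat) :
  computable_fun k n -> computable_fun k f ->
  computable_fun k.+2
    (fun w => g (nth 0 w 0) (nth 0 w 1) (behead (behead w))) ->
  computable_fun k
    (fun v => nat_rect (fun=> nat) (f v) (fun i s => g i s v) (n v)).
Proof.
move=> cn cf cg.
pose h v := nat_rect (fun=> nat) (f (behead v))
  (fun i s => g i s (behead v)) (nth 0 v 0).
have ch : computable_fun k.+1 h.
  have := pr_prec cf cg; congr partial_recursive.
  apply/funext => v; apply/funext => y; case/tupleP: v => a v.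
  rewrite /pprec theadE /h /=; apply/propext; split => [[s [s0 sS ->]]|->].
    suff: forall i, i <= a -> s i = nat_rect (fun=> nat) (f v)
        (fun i s => g i s v) i by exact.
    elim=> [_|i IH ia]; first by rewrite s0.
    by rewrite sS// IH// ltnW.
  exists (nat_rect (fun=> nat) (f v) (fun i s => g i s v)); split => //.
have := @computable_comp k k.+1 h (fun i => if i is j.+1 then nth 0 ^~ j else n)
  ch.
have -> // : (fun v => h (mkseq (fun i =>
    (if i is j.+1 then nth 0 ^~ j else n) v) k.+1)) =
  fun v => h (n v :: mkseq (nth 0 v) k).
  apply/funext => v; congr h; rewrite /mkseq /=; congr cons.
  by rewrite -[1]addn0 iotaDl -map_comp.
move=> H; apply: eq_computable_fun (H _) => [v vk|[|i]//].
  by rewrite /h /= -vk mkseq_nth.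
by move=> ik; exact: (@computable_var k i ik).
Qed.

Lemma computable_behead k (g : seq nat -> seq nat) i :
  computable_fun k (fun w => nth 0 (g w) i.+1) ->
  computable_fun k (fun w => nth 0 (behead (g w)) i).
Proof. by apply: eq_computable_fun => w _; rewrite nth_behead. Qed.

Lemma computable_add k f g : computable_fun k f -> computable_fun k g ->
  computable_fun k (fun v => f v + g v).
Proof.
move=> cf cg.
apply: (@eq_computable_fun _ (fun v =>
  nat_rect (fun=> nat) (f v) (fun i s => s.+1) (g v))) => [v _|].
  by elim: (g v) => /= [|n ->]; rewrite ?addn0 ?addnS.
by apply: computable_rec => //; apply: computable_succ; exact: computable_var.
Qed.

Lemma computable_weaken k f : computable_fun k f ->
  computable_fun k.+1 (fun w => f (behead w)).
Proof.
move=> cf; apply: (@eq_computable_fun _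
  (fun w => f (mkseq (fun i => nth 0 w i.+1) k))) => [w wk|].
  rewrite -[in RHS](mkseq_nth 0 (behead w)) size_behead wk/=; congr f.
  by apply: eq_mkseq => i; rewrite nth_behead.
by apply: (@computable_comp _ k f) => // i ik; exact: computable_var.
Qed.

Lemma computable_sum k n (g : nat -> seq nat -> nat) :
  computable_fun k n ->
  computable_fun k.+1 (fun w => g (nth 0 w 0) (behead w)) ->
  computable_fun k (fun v => \sum_(0 <= i < n v) g i v).
Proof.
move=> cn cg; apply: (@eq_computable_fun _ (fun v =>
  nat_rect (fun=> nat) 0 (fun i s => s + g i v) (n v))) => [v _|].
  elim: (n v) => /= [|m ->]; first by rewrite big_nil.
  by rewrite big_nat_recr.
apply: (computable_rec (g := fun i s v => s + g i v)) => //.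
  exact: computable_const.
apply: computable_add; first exact: computable_var.
apply: (@eq_computable_fun _ (fun w =>
  (fun u => g (nth 0 u 0) (behead u))
  (mkseq (fun i => nth 0 w (if i is j.+1 then j.+2 else 0)) k.+1))) => [w wk|].
  rewrite /= /mkseq -[1]addn0 iotaDl -map_comp; congr (g _ _).
  apply: (@eq_from_nth _ 0); first by rewrite size_map size_iota !size_behead wk.
  move=> i; rewrite size_map size_iota => ik.
  by rewrite (nth_map 0) ?size_iota// nth_iota// !nth_behead.
apply: (@computable_comp _ k.+1 (fun u => g (nth 0 u 0) (behead u))) => //.
by case=> [|i] ik; exact: computable_var.
Qed.

Lemma computable_mul k f g : computable_fun k f -> computable_fun k g ->
  computable_fun k (fun v => f v * g v).
Proof.
move=> cf cg; apply: (@eq_computable_fun _ (fun v =>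
  \sum_(0 <= i < g v) f v)) => [v _|].
  by rewrite sum_nat_const_nat subn0 mulnC.
by apply: (computable_sum (g := fun _ => f)) => //; exact: computable_weaken.
Qed.

Lemma computable_pow k f g : computable_fun k f -> computable_fun k g ->
  computable_fun k (fun v => f v ^ g v).
Proof.
move=> cf cg; apply: (@eq_computable_fun _ (fun v =>
  nat_rect (fun=> nat) 1 (fun i s => s * f v) (g v))) => [v _|].
  by elim: (g v) => //= n ->; rewrite expnSr.
apply: (computable_rec (g := fun i s v => s * f v)) => //.
  exact: computable_const.
apply: computable_mul; first exact: computable_var.
exact: (computable_weaken (computable_weaken cf)).
Qed.

Lemma computable_pred k f : computable_fun k f ->
  computable_fun k (fun v => (f v).-1).
Proof.
move=> cf; apply: (@eq_computable_fun _ (fun v =>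
  nat_rect (fun=> nat) 0 (fun i s => i) (f v))) => [v _|]; first by case: (f v).
apply: (computable_rec (g := fun i s v => i)) => //.
  exact: computable_const.
exact: computable_var.
Qed.

Lemma computable_sub k f g : computable_fun k f -> computable_fun k g ->
  computable_fun k (fun v => f v - g v).
Proof.
move=> cf cg; apply: (@eq_computable_fun _ (fun v =>
  nat_rect (fun=> nat) (f v) (fun i s => s.-1) (g v))) => [v _|].
  by elim: (g v) => [|n IH]; rewrite ?subn0//= IH subnS.
apply: (computable_rec (g := fun i s v => s.-1)) => //.
by apply: computable_pred; exact: computable_var.
Qed.

Lemma computable_leq k f g : computable_fun k f -> computable_fun k g ->
  computable_fun k (fun v => nat_of_bool (f v <= g v)).
Proof.
move=> cf cg; apply: (@eq_computable_fun _ (fun v => 1 - (f v - g v))).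
  by move=> v _; rewrite /leq; case: (f v - g v).
apply: computable_sub; first exact: computable_const.
exact: computable_sub.
Qed.

Lemma computable_eq k f g : computable_fun k f -> computable_fun k g ->
  computable_fun k (fun v => nat_of_bool (f v == g v)).
Proof.
move=> cf cg; apply: (@eq_computable_fun _ (fun v =>
  (f v <= g v) * (g v <= f v))).
  by move=> v _; rewrite eqn_leq mulnb.
by apply: computable_mul; exact: computable_leq.
Qed.

Lemma computable_odd k f : computable_fun k f ->
  computable_fun k (fun v => nat_of_bool (odd (f v))).
Proof.
move=> cf; apply: (@eq_computable_fun _ (fun v =>
  nat_rect (fun=> nat) 0 (fun i s => 1 - s) (f v))) => [v _|].
  by elim: (f v) => //= n ->; case: (odd n).
apply: (computable_rec (g := fun i s v => 1 - s)) => //.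
  exact: computable_const.
apply: computable_sub; first exact: computable_const.
exact: computable_var.
Qed.

Lemma computable_fact k f : computable_fun k f ->
  computable_fun k (fun v => (f v)`!).
Proof.
move=> cf; apply: (@eq_computable_fun _ (fun v =>
  nat_rect (fun=> nat) 1 (fun i s => i.+1 * s) (f v))) => [v _|].
  by elim: (f v) => //= n ->.
apply: (computable_rec (g := fun i s v => i.+1 * s)) => //.
  exact: computable_const.
apply: computable_mul; first apply: computable_succ; exact: computable_var.
Qed.

(** The quotient is the number of positive multiples of the divisor that do not
    exceed the dividend. *)
Lemma computable_div k f g : computable_fun k f -> computable_fun k g ->
  computable_fun k (fun v => f v %/ g v).
Proof.
move=> cf cg; apply: (@eq_computable_fun _ (fun v =>
  (1 <= g v) * \sum_(0 <= i < f v) (i.+1 * g v <= f v))) => [v _|].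
  case: posnP => [->|g0]; first by rewrite divn0.
  rewrite mul1n; under eq_bigr do rewrite -leq_divRL//.
  rewrite (@big_cat_nat _ _ _ (f v %/ g v))//= ?leq_div//.
  rewrite [X in X + _]big_nat [X in _ + X]big_nat.
  rewrite (eq_bigr (fun=> 1)) => [|i /andP[_ ->]//].
  rewrite [X in _ + X]big1 => [|i /andP[gi _]]; last first.
    by rewrite leqNgt ltnS gi.
  by rewrite addn0 -big_nat sum_nat_const_nat subn0 muln1.
apply: computable_mul.
  by apply: computable_leq => //; exact: computable_const.
apply: (computable_sum (g := fun i v => nat_of_bool (i.+1 * g v <= f v))) => //.
apply: computable_leq; last exact: computable_weaken.
apply: computable_mul; last exact: computable_weaken.
by apply: computable_succ; exact: computable_var.
Qed.

End TotalComputable.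

(** Proves computability of an arithmetical expression in the variables
    [nth 0 v i] by structural recursion on the expression. *)
Ltac computability :=
  cbv beta; lazymatch goal with
  | |- computable_fun _ (fun v => nth _ v _) => by apply: computable_var
  | |- computable_fun _ (fun v => nth _ (behead _) _) =>
      apply: computable_behead; computability
  | |- computable_fun _ (fun v => (_ + _)%N) =>
      apply: computable_add; computability
  | |- computable_fun _ (fun v => (_ - _)%N) =>
      apply: computable_sub; computability
  | |- computable_fun _ (fun v => (_ * _)%N) =>
      apply: computable_mul; computability
  | |- computable_fun _ (fun v => (_ ^ _)%N) =>
      apply: computable_pow; computability
  | |- computable_fun _ (fun v => (_ %/ _)%N) =>
      apply: computable_div; computability
  | |- computable_fun _ (fun v => (_ `!)%N) =>
      apply: computable_fact; computability
  | |- computable_fun _ (fun v => nat_of_bool (_ <= _)%N) =>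
      apply: computable_leq; computability
  | |- computable_fun _ (fun v => nat_of_bool (odd _)) =>
      apply: computable_odd; computability
  | |- computable_fun _ (fun v => nat_of_bool (_ == _)) =>
      apply: computable_eq; computability
  | |- computable_fun _ (fun v => \sum_(0 <= i < _) _)%N =>
      apply: computable_sum; computability
  | |- computable_fun _ (fun v => S _) =>
      first [by apply: computable_const | apply: computable_succ; computability]
  | |- computable_fun _ (fun v => ?h _ _) =>
      apply: (computable2_fun (h := h)); [by [] | computability | computability]
  | |- computable_fun _ (fun v => ?h _) =>
      apply: (computable1_fun (h := h)); [by [] | computability]
  | |- computable_fun _ _ => by apply: computable_const
  end.


(** * Computable sequences of reals *)

(** A difference of naturals over a common denominator: sums and products of
    such expressions are again of this form, with neither signs to distinguish
    nor roundings to perform. *)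
Definition difference_computable (R : realType) (x : nat -> R) : Prop :=
  exists p m q : nat -> nat -> nat,
    [/\ computable2 p, computable2 m, computable2 q,
        forall n k, (0 < q n k)%N
      & forall n k, `|x n - ((p n k)%:R - (m n k)%:R) / (q n k)%:R| <= 2 ^- k].

Lemma computable_seq_difference (R : realType) (x : nat -> R) :
  computable_seq x -> difference_computable x.
Proof.
move=> [s [p [q [cs cp cq q0 xE]]]].
exists (fun n k => p n k * (1 - odd (s n k)))%N,
  (fun n k => p n k * odd (s n k))%N, q; split => //.
- by apply: computable2P; computability.
- by apply: computable2P; computability.
- by move=> n k; rewrite lt0n.
- move=> n k; have := xE n k; rewrite -signr_odd.
  by case: odd; rewrite ?expr1 ?expr0 ?mulN1r ?mul1r ?muln0 ?muln1 ?sub0r ?subr0.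
Qed.

Lemma difference_computable_nat (R : realType) (f : nat -> nat) :
  computable1 f -> difference_computable (fun n => (f n)%:R : R).
Proof.
move=> cf; exists (fun n k => f n), (fun n k => 0%N), (fun n k => 1%N).
split => //; try by apply: computable2P; computability.
by move=> n k; rewrite subr0 divr1 subrr normr0 invr_ge0 exprn_ge0.
Qed.

Lemma expr2V_S (R : realType) k : 2 ^- k.+1 *+ 2 = 2 ^- k :> R.
Proof. by rewrite mulr2n exprS; field; rewrite expf_neq0. Qed.

Lemma difference_computable_add (R : realType) (x y : nat -> R) :
  difference_computable x -> difference_computable y ->
  difference_computable (fun n => x n + y n).
Proof.
move=> [p [m [q [cp cm cq q0 xE]]]] [p' [m' [q' [cp' cm' cq' q'0 yE]]]].
exists (fun n k => p n k.+1 * q' n k.+1 + p' n k.+1 * q n k.+1)%N,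
  (fun n k => m n k.+1 * q' n k.+1 + m' n k.+1 * q n k.+1)%N,
  (fun n k => q n k.+1 * q' n k.+1)%N; split.
- by apply: computable2P; computability.
- by apply: computable2P; computability.
- by apply: computable2P; computability.
- by move=> n k; rewrite muln_gt0 q0 q'0.
- move=> n k; have Q : (q n k.+1)%:R != 0 :> R by rewrite pnatr_eq0 -lt0n.
  have Q' : (q' n k.+1)%:R != 0 :> R by rewrite pnatr_eq0 -lt0n.
  rewrite [X in `|X|](_ : _ =
    (x n - ((p n k.+1)%:R - (m n k.+1)%:R) / (q n k.+1)%:R) +
    (y n - ((p' n k.+1)%:R - (m' n k.+1)%:R) / (q' n k.+1)%:R)); last first.
    by rewrite !natrD !natrM; field; rewrite Q Q'.
  rewrite (le_trans (ler_normD _ _))// -expr2V_S mulr2n.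
  exact: lerD.
Qed.

(** A computable bound on [`|x|], read off from any of its approximations; it
    governs the precision needed for products and for cosines. *)
Lemma approximation_bound (R : realType) (x : R) (p m q : nat) k :
  (0 < q)%N -> `|x - (p%:R - m%:R) / q%:R| <= 2 ^- k ->
  `|x| <= (p + m).+1%:R /\ `|(p%:R - m%:R) / q%:R : R| <= (p + m)%:R.
Proof.
move=> q0 xE.
have B : `|(p%:R - m%:R) / q%:R : R| <= (p + m)%:R.
  rewrite normrM normfV normr_nat ler_pdivrMr ?ltr0n//.
  rewrite (@le_trans _ _ (p + m)%:R)// ?ler_peMr ?ler1n//.
  by rewrite (le_trans (ler_normB _ _))// !normr_nat natrD.
split => //; rewrite -[x](subrK ((p%:R - m%:R) / q%:R)).
rewrite (le_trans (ler_normD _ _))// -addn1 natrD addrC lerD//.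
by rewrite (le_trans xE)// invf_le1 ?exprn_gt0// exprn_ege1// ler1n.
Qed.

Lemma difference_computable_mul (R : realType) (x y : nat -> R) :
  difference_computable x -> difference_computable y ->
  difference_computable (fun n => x n * y n).
Proof.
move=> [p [m [q [cp cm cq q0 xE]]]] [p' [m' [q' [cp' cm' cq' q'0 yE]]]].
(* Approximating both factors within [2 ^- l] costs at most
   [2 ^- l * (`|x n| + `|y n| + 1)], which is at most [2 ^- l * (l - k)] for
   this [l = e n k], and [l - k <= 2 ^ (l - k)]. *)
pose e n k := (k + ((p n 0 + m n 0).+1 + ((p' n 0 + m' n 0).+1 + 1)))%N.
have ce : computable2 e by apply: computable2P; rewrite /e; computability.
exists (fun n k => p n (e n k) * p' n (e n k) + m n (e n k) * m' n (e n k))%N,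
  (fun n k => p n (e n k) * m' n (e n k) + m n (e n k) * p' n (e n k))%N,
  (fun n k => q n (e n k) * q' n (e n k))%N; split.
- by apply: computable2P; computability.
- by apply: computable2P; computability.
- by apply: computable2P; computability.
- by move=> n k; rewrite muln_gt0 q0 q'0.
- move=> n k; set l := e n k.
  have Q : (q n l)%:R != 0 :> R by rewrite pnatr_eq0 -lt0n.
  have Q' : (q' n l)%:R != 0 :> R by rewrite pnatr_eq0 -lt0n.
  have [Bx _] := approximation_bound (q0 n 0%N) (xE n 0%N).
  have [By _] := approximation_bound (q'0 n 0%N) (yE n 0%N).
  have := xE n l; have := yE n l.
  set u := (_ / _ : R) => yu; set v := (_ / _ : R) => xv.
  rewrite [X in `|X|](_ : _ = (x n - v) * y n + x n * (y n - u) -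
    (x n - v) * (y n - u)); last first.
    by rewrite /u /v !natrD !natrM; field; rewrite Q Q'.
  have l1 : 2 ^- l <= 1 :> R.
    by rewrite invf_le1 ?exprn_gt0// exprn_ege1// ler1n.
  rewrite (@le_trans _ _ (2 ^- l * (l - k)%:R))//.
    rewrite /l /e addKn !natrD.
    rewrite (le_trans (ler_normB _ _))// (le_trans (lerD (ler_normD _ _) (lexx _)))//.
    rewrite !normrM (_ : forall a b c d : R,
      a * (b + (c + d)) = a * c + b * a + a * d); last by move=> *; ring.
    rewrite !lerD// ler_pM// ?normr_ge0//.
    exact: le_trans l1.
  have kl : (k <= l)%N by rewrite /l /e leq_addr.
  rewrite -{1}(subnK kl) exprD invfM mulrAC ler_piMl//.
  rewrite mulrC ler_pdivrMr ?exprn_gt0// mul1r -natrX ler_nat.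
  by rewrite ltnW// ltn_expl.
Qed.

Lemma cos_lipschitz (R : realType) (x y : R) : `|cos x - cos y| <= `|x - y|.
Proof.
wlog xy : x y / x <= y => [H|].
  by case/orP: (le_total x y) => /H//; rewrite distrC [leRHS]distrC.
have [||c _] := @MVT_segment R cos (fun z => - sin z) x y => //.
  by apply: continuous_subspaceT; exact: continuous_cos.
rewrite distrC [leRHS]distrC => ->; rewrite normrM normrN.
by rewrite ler_piMl// sin_max.
Qed.
Lemma sum_alternating_double (R : comPzRingType) (f : nat -> R) n :
  \sum_(0 <= i < 2 * n) (-1) ^+ i * f i =
  \sum_(0 <= i < n) f (2 * i)%N - \sum_(0 <= i < n) f (2 * i).+1.
Proof.
elim: n => [|n IH]; first by rewrite !big_nil subr0.
rewrite mulnS !big_nat_recr//= IH -signr_odd -[(-1) ^+ (2 * n).+1]signr_odd/=.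
by rewrite oddM/= mul1r mulN1r; ring.
Qed.

(** The terms from the [n]th on are dominated by a geometric series of sum
    [2 * C * 2 ^- n]. *)
Lemma geometric_tail (R : realType) (c : nat -> R) (C l : R) :
  series c @ \oo --> l -> (forall i, `|c i| <= C * 2 ^- i) ->
  forall n, `|l - \sum_(0 <= i < n) c i| <= 2 * C * 2 ^- n.
Proof.
move=> cl cC n.
have tail k : `|series c (n + k)%N - series c n| <=
    2 * C * (2 ^- n - 2 ^- (n + k)%N).
  elim: k => [|k IH]; first by rewrite addn0 !subrr normr0 mulr0.
  rewrite addnS /series/= big_nat_recr//= addrAC.
  rewrite (le_trans (ler_normD _ _))// (le_trans (lerD IH (cC _)))//.
  rewrite -(expr2V_S _ (n + k)) mulr2n le_eqVlt; apply/orP; left.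
  by apply/eqP; ring.
have C0 : 0 <= C.
  by have := cC 0%N; rewrite expr0 invr1 mulr1; apply: le_trans.
apply: (cvgr_to_le (cvg_norm (cvgB cl (cvg_cst (series c n))))); near=> m.
have nm : (n <= m)%N by near: m; exact: nbhs_infty_ge.
rewrite -(subnKC nm) /= (le_trans (tail _))// ler_wpM2l ?mulr_ge0//.
by rewrite gerBl invr_ge0 exprn_ge0.
Unshelve. all: by end_near. Qed.

(** The quotient [A ^ n / n`!] grows up to [n = A] and decreases afterwards. *)
Lemma expn_le_fact A n : (0 < A)%N -> (A ^ n <= A ^ A * n`!)%N.
Proof.
move=> A0; case: (leqP n A) => [nA|/ltnW An].
  by rewrite (leq_trans (leq_pexp2l A0 nA))// leq_pmulr// fact_gt0.
rewrite -(subnKC An); elim: (n - A)%N => [|k IH].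
  by rewrite addn0 leq_pmulr// fact_gt0.
rewrite addnS expnSr factS mulnCA mulnC leq_mul//.
by rewrite (leq_trans (leq_addr k A)).
Qed.

(** With [2 * `|u| <= A], the [i]th term is at most
    [2 ^- (2 * i) * A ^ (2 * i) / (2 * i)`!], hence at most [A ^ A * 2 ^- i]. *)
Lemma cos_taylor (R : realType) (u : R) (A n : nat) : (0 < A)%N ->
  2 * `|u| <= A%:R ->
  `|cos u - \sum_(0 <= i < n) (-1) ^+ i * (u ^+ 2) ^+ i / (2 * i)`!%:R|
    <= 2 * (A ^ A)%:R * 2 ^- n.
Proof.
move=> A0 uA.
under eq_bigr do rewrite -exprM mul2n.
apply: geometric_tail; first exact: cvg_cos_coeff'.
move=> i; rewrite !normrM normfV normr_nat normrX normrN1 expr1n mul1r.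
rewrite normrX ler_pdivrMr ?ltr0n ?fact_gt0// mulrAC ler_pdivlMr ?exprn_gt0//.
have := expn_le_fact i.*2 A0; rewrite -(ler_nat R) natrM.
apply: le_trans; rewrite natrX.
rewrite (@le_trans _ _ ((2 * `|u|) ^+ i.*2))//; last first.
  by rewrite lerXn2r ?nnegrE ?mulr_ge0.
rewrite exprMn mulrC ler_wpM2r ?exprn_ge0// -!natrX ler_nat leq_exp2l//.
by rewrite -addnn leq_addr.
Qed.

(** The numerator of the [i]th term, up to sign, of the cosine series of a
    square root of [D / Q] over the denominator [Q ^ n * (2 * n)`!]. *)
Definition cos_numer (D Q n i : nat) : nat :=
  (D ^ i * Q ^ (n - i) * ((2 * n)`! %/ (2 * i)`!))%N.

Lemma cos_numerE (R : realType) (D Q n i : nat) : (0 < Q)%N -> (i <= n)%N ->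
  (cos_numer D Q n i)%:R / (Q ^ n * (2 * n)`!)%:R =
  (D%:R / Q%:R) ^+ i / (2 * i)`!%:R :> R.
Proof.
move=> Q0 ile.
have -> : (cos_numer D Q n i)%:R = (D%:R ^+ i * Q%:R ^+ (n - i) *
    ((2 * n)`!%:R / (2 * i)`!%:R)) :> R.
  rewrite /cos_numer !natrM !natrX natf_div//.
  have le2 : (2 * i <= 2 * n)%N by rewrite leq_mul2l.
  by rewrite -(ffact_fact (leq_subr (2 * i) (2 * n))) subKn// dvdn_mull.
have Qn : Q%:R != 0 :> R by rewrite pnatr_eq0 -lt0n.
have En : (2 * n)`!%:R != 0 :> R by rewrite pnatr_eq0 -lt0n fact_gt0.
have Ei : (2 * i)`!%:R != 0 :> R by rewrite pnatr_eq0 -lt0n fact_gt0.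
rewrite natrM natrX -[in (Q%:R ^+ n)](subnK ile) exprD expr_div_n.
by field; rewrite En Ei !expf_neq0.
Qed.

Lemma difference_computable_cos (R : realType) (x : nat -> R) :
  difference_computable x -> difference_computable (fun n => cos (x n)).
Proof.
move=> [p [m [q [cp cm cq q0 xE]]]].
(* The argument is approximated within [2 ^- k.+1] by [(p - m) / q], of square
   [D / Q]; the other half of the error is left to the Taylor polynomial, whose
   [2 * N] terms are split into the positive and the negative ones. *)
pose D n k := (p n k.+1 * p n k.+1 + m n k.+1 * m n k.+1 -
  2 * p n k.+1 * m n k.+1)%N.
pose Q n k := (q n k.+1 * q n k.+1)%N.
pose A n k := (2 * (p n k.+1 + m n k.+1) + 1)%N.
pose N n k := (k + 2 + A n k ^ A n k)%N.
have cD : computable2 D by apply: computable2P; rewrite /D; computability.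
have cQ : computable2 Q by apply: computable2P; rewrite /Q; computability.
have cA : computable2 A by apply: computable2P; rewrite /A; computability.
have cN : computable2 N by apply: computable2P; rewrite /N; computability.
exists (fun n k => \sum_(0 <= i < N n k)
    cos_numer (D n k) (Q n k) (2 * N n k) (2 * i))%N,
  (fun n k => \sum_(0 <= i < N n k)
    cos_numer (D n k) (Q n k) (2 * N n k) (2 * i).+1)%N,
  (fun n k => Q n k ^ (2 * N n k) * (2 * (2 * N n k))`!)%N; split.
- by apply: computable2P; rewrite /cos_numer; computability.
- by apply: computable2P; rewrite /cos_numer; computability.
- by apply: computable2P; computability.
- by move=> n k; rewrite muln_gt0 fact_gt0 expn_gt0 muln_gt0 q0.
- move=> n k.
  have Q0 : (0 < Q n k)%N by rewrite muln_gt0 q0.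
  have Dle : (2 * p n k.+1 * m n k.+1 <=
      p n k.+1 * p n k.+1 + m n k.+1 * m n k.+1)%N.
    by have := (nat_Cauchy (p n k.+1) (m n k.+1)).1; rewrite !mulnn mulnA.
  have := xE n k.+1; set u := (_ / _ : R) => xu.
  have [_ uB] := approximation_bound (q0 n k.+1) xu.
  have u2 : u ^+ 2 = (D n k)%:R / (Q n k)%:R.
    rewrite /u /D /Q natrB// !natrD !natrM; field.
    by rewrite pnatr_eq0 -lt0n.
  rewrite [X in `|_ - X|](_ : _ = \sum_(0 <= i < 2 * N n k)
      (-1) ^+ i * (u ^+ 2) ^+ i / (2 * i)`!%:R); last first.
    under [RHS]eq_bigr do rewrite -mulrA u2.
    rewrite sum_alternating_double mulrBl !natr_sum !mulr_suml.
    congr (_ - _); apply: eq_big_nat => i /andP[_ iN].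
      by rewrite cos_numerE// leq_mul2l/= ltnW.
    by rewrite cos_numerE// ltn_mul2l.
  rewrite -[X in `|X|](subrKA (cos u)) (le_trans (ler_normD _ _))//.
  rewrite -expr2V_S mulr2n lerD//.
    exact: le_trans (cos_lipschitz _ _) _.
  have A0 : (0 < A n k)%N by rewrite /A addn1.
  have uA : 2 * `|u| <= (A n k)%:R.
    by rewrite /A natrD natrM -[leLHS]addr0 lerD// ler_wpM2l.
  rewrite (le_trans (cos_taylor _ A0 uA))//.
  rewrite ler_pdivrMr ?exprn_gt0// [leRHS]mulrC ler_pdivlMr ?exprn_gt0//.
  rewrite -!natrX -!natrM ler_nat /N.
  rewrite (@leq_trans (2 ^ (1 + A n k ^ A n k + k.+1)))//.
    by rewrite expnD leq_mul// expnD leq_mul// ltnW// ltn_expl.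
  by rewrite leq_exp2l//; lia.
Qed.

Lemma is_derive_arctan_sum (R : realType) (n : nat) (z : R) :
  is_derive z 1
    (fun y : R => \sum_(0 <= i < n) (-1) ^+ i * (y ^+ (2 * i).+1 / (2 * i).+1%:R))
    (\sum_(0 <= i < n) (- z ^+ 2) ^+ i).
Proof.
elim: n => [|n IH].
  rewrite big_nil; under [X in is_derive _ _ X]funext do rewrite big_nil.
  exact: is_derive_cst.
rewrite big_nat_recr//=.
under [X in is_derive _ _ X]funext do rewrite big_nat_recr//=.
apply: is_deriveD.
have d := is_deriveZ ((-1) ^+ n / (2 * n).+1%:R)
  (is_deriveX (2 * n).+1 (is_derive_id z (1 : R))).
move: d; congr is_derive.
  by apply/funext => y; rewrite !fctE mulrA mulrAC.
rewrite /GRing.scale/= mulr1 (exprNn (z ^+ 2)) -exprM mulrA.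
by rewrite divfK// pnatr_eq0.
Qed.

(** Both [y ^+ (2 * n).+1 / (2 * n).+1%:R] plus and minus the error of the [n]th
    partial sum of the arctangent series have a nonnegative derivative. *)
Lemma leibniz_sum (R : realType) (n : nat) :
  `|pi / 4 - \sum_(0 <= i < n) (-1) ^+ i * (2 * i).+1%:R^-1 : R|
    <= (2 * n).+1%:R^-1.
Proof.
pose f (y : R) : R :=
  \sum_(0 <= i < n) (-1) ^+ i * (y ^+ (2 * i).+1 / (2 * i).+1%:R).
suff H (s : R) : `|s| <= 1 -> s * (atan 1 - f 1) <= (2 * n).+1%:R^-1.
  have f1 : f 1 = \sum_(0 <= i < n) (-1) ^+ i * (2 * i).+1%:R^-1.
    by apply: eq_bigr => i _; rewrite expr1n mul1r.
  rewrite -f1 -atan1 ler_norml; apply/andP; split.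
    by have := H (-1); rewrite normrN1 mulN1r lerNl; exact.
  by have := H 1; rewrite normr1 mul1r; exact.
move=> s1.
(* Choosing [s] to be [1] or [-1] gives the two bounds. *)
pose g (y : R) : R := (2 * n).+1%:R^-1 * y ^+ (2 * n).+1 - s * (atan y - f y).
pose dg (y : R) : R := y ^+ (2 * n) -
  s * ((1 + y ^+ 2)^-1 - \sum_(0 <= i < n) (- y ^+ 2) ^+ i).
have gd (z : R) : is_derive z 1 g (dg z).
  have d1 := is_deriveZ (2 * n).+1%:R^-1
    (is_deriveX (2 * n).+1 (is_derive_id z (1 : R))).
  have d2 := is_deriveZ s (is_deriveB (is_derive1_atan z)
    (is_derive_arctan_sum n z)).
  move: (is_deriveB d1 d2); congr is_derive.
    by apply/funext => y; rewrite !fctE.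
  by rewrite /dg /GRing.scale/= mulr1 mulrA mulVf ?mul1r// pnatr_eq0.
have [|c] := @MVT_segment R g dg 0 1 ler01 (fun z _ => gd z).
  by apply: derivable_within_continuous => z _; exact: ex_derive.
rewrite in_itv/= => /andP[c0 _] E.
have : 0 <= g 1 - g 0.
  rewrite E subr0 mulr1 /dg subr_ge0.
  have c2 : 1 + c ^+ 2 != 0 by rewrite gt_eqF// ltr_pwDl// sqr_ge0.
  have -> : \sum_(0 <= i < n) (- c ^+ 2) ^+ i =
      (1 - (- c ^+ 2) ^+ n) / (1 + c ^+ 2).
    apply: (mulIf c2); rewrite divfK// big_mkord.
    have := subrX1 (- c ^+ 2) n; move=> /(congr1 -%R); rewrite opprB => ->.
    by ring.
  rewrite -[X in X - _]div1r -mulrBl opprB addrC subrK mulrA.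
  rewrite ler_pdivrMr ?ltr_pwDl ?sqr_ge0// (@le_trans _ _ (c ^+ (2 * n)))//.
    rewrite (le_trans (ler_norm _))// normrM (exprNn (c ^+ 2)) -exprM normrM normrX normrN1.
    by rewrite expr1n mul1r (ger0_norm (exprn_ge0 _ c0)) ler_piMl ?exprn_ge0.
  by rewrite ler_peMr ?exprn_ge0// lerDl sqr_ge0.
have g0 : g 0 = 0.
  rewrite /g atan0 /f exprS mul0r mulr0 big1 ?subrr ?mulr0 ?subr0// => i _.
  by rewrite exprS !mul0r mulr0.
by rewrite g0 subr0 subr_ge0 expr1n mulr1.
Qed.

Lemma difference_computable_pi (R : realType) :
  difference_computable (fun=> pi : R).
Proof.
(* The first [2 * N] terms of the series leave an error of at most
   [4 / (4 * N + 1)], so [N = 2 ^ k] is enough. *)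
pose F k := ((4 * 2 ^ k)`!)%N.
have cF : computable1 F by apply: computable1P; rewrite /F; computability.
have dvdF k i : (i < 4 * 2 ^ k)%N -> (i.+1 %| F k)%N.
  by move=> ik; rewrite dvdn_fact.
exists (fun n k => \sum_(0 <= i < 2 ^ k) 4 * (F k %/ (4 * i + 1)))%N,
  (fun n k => \sum_(0 <= i < 2 ^ k) 4 * (F k %/ (4 * i + 3)))%N,
  (fun n k => F k); split.
- by apply: computable2P; computability.
- by apply: computable2P; computability.
- by apply: computable2P; computability.
- by move=> n k; rewrite fact_gt0.
- move=> n k.
  have F0 : (F k)%:R != 0 :> R by rewrite pnatr_eq0 -lt0n fact_gt0.
  have -> : ((\sum_(0 <= i < 2 ^ k) 4 * (F k %/ (4 * i + 1)))%:R -
      (\sum_(0 <= i < 2 ^ k) 4 * (F k %/ (4 * i + 3)))%:R) / (F k)%:R =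
      4 * \sum_(0 <= i < 2 * 2 ^ k) (-1) ^+ i * (2 * i).+1%:R^-1 :> R.
    rewrite sum_alternating_double mulrBl !natr_sum !mulr_suml mulrBr !mulr_sumr.
    congr (_ - _); apply: eq_big_nat => i /andP[_ ik].
      rewrite (_ : (2 * (2 * i)).+1 = 4 * i + 1)%N; last by lia.
      rewrite natrM natf_div ?addn1 ?dvdF//; last by lia.
      by rewrite -mulrA [_ / (F k)%:R]mulrAC divff// mul1r.
    rewrite (_ : (2 * (2 * i).+1).+1 = 4 * i + 3)%N; last by lia.
    rewrite natrM natf_div ?(addnS _ 2) ?dvdF//; last by lia.
    by rewrite -mulrA [_ / (F k)%:R]mulrAC divff// mul1r.
  rewrite [X in X - _](_ : pi = 4 * (pi / 4)) -?mulrBr; last by field.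
  rewrite normrM ger0_norm// (le_trans (ler_wpM2l _ (leibniz_sum _ _)))//.
  rewrite ler_pdivrMr ?ltr0n// mulrC ler_pdivlMr ?exprn_gt0//.
  by rewrite -natrX -natrM ler_nat; lia.
Qed.

(** With the denominator [2 ^ n], a signed sum of the first [i] terms becomes an
    integer after scaling by [2 ^ i], and comparing it to a bound is arithmetic. *)
Lemma dyadic_approximation (R : realType) (x : nat -> R) :
  difference_computable x ->
  exists p m : nat -> nat, [/\ computable1 p, computable1 m &
    forall n, `|x n - ((p n)%:R - (m n)%:R) / 2 ^+ n| <= 2 * 2 ^- n].
Proof.
move=> [p [m [q [cp cm cq q0 xE]]]].
exists (fun n => p n n * 2 ^ n %/ q n n)%N, (fun n => m n n * 2 ^ n %/ q n n)%N.
split.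
- by apply: computable1P; computability.
- by apply: computable1P; computability.
- move=> n; have Q0 : 0 < (q n n)%:R :> R by rewrite ltr0n.
  have trunc a : let e : R := (a * 2 ^ n)%:R / (q n n)%:R -
      (a * 2 ^ n %/ q n n)%:R in 0 <= e <= 1.
    rewrite (_ : _ - _ = (a * 2 ^ n %% q n n)%:R / (q n n)%:R :> R).
      rewrite /= divr_ge0//= ler_pdivrMr// mul1r.
      by rewrite ler_nat ltnW// ltn_mod.
    rewrite {1}(divn_eq (a * 2 ^ n) (q n n)) natrD natrM mulrDl.
    by rewrite mulfK ?gt_eqF// addrAC subrr add0r.
  have /andP[] := trunc (p n n); have /andP[] := trunc (m n n).
  set em := (_ - _ : R); set ep := (_ - _ : R) => em0 em1 ep0 ep1.
  have E : x n - ((p n n * 2 ^ n %/ q n n)%:R -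
      (m n n * 2 ^ n %/ q n n)%:R) / 2 ^+ n =
      (x n - ((p n n)%:R - (m n n)%:R) / (q n n)%:R) + (ep - em) / 2 ^+ n.
    rewrite /ep /em !natrM natrX; field.
    by rewrite expf_neq0//= gt_eqF.
  rewrite E (le_trans (ler_normD _ _))// mulr_natl mulr2n lerD//.
  rewrite normrM normfV [`|2 ^+ n|]ger0_norm ?exprn_ge0//.
  by rewrite ler_piMl// ler_norml; lra.
Qed.

(** * Compression of a sparse decidable family of strings *)

Section Strings.
Local Open Scope nat_scope.

Lemma string_code_inj : injective string_code.
Proof.
elim=> [|b s IH] [|b' s']//= [E].
have bb : b = b'.
  have := congr1 odd E; rewrite !oddD !odd_double.
  by case: (b) (b') => [] [].
by move: E; rewrite bb => /eqP; rewrite eqn_add2r => /eqP /double_inj /IH ->.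
Qed.

Lemma string_code_surj c : exists s, string_code s = c.
Proof.
elim/ltn_ind: c => [[|c]] IH; first by exists [::].
have [|s sc] := IH c./2; first by rewrite ltnS -divn2 leq_div.
by exists (odd c :: s); rewrite /= sc addnC odd_double_half.
Qed.

Lemma string_code_bounds s :
  2 ^ size s <= (string_code s).+1 < 2 ^ (size s).+1.
Proof.
by elim: s => [//|b s /andP[l r]] /=; rewrite !expnS in r *; case: b; lia.
Qed.

Lemma string_code_size s n :
  2 ^ n <= (string_code s).+1 < 2 ^ n.+1 -> size s = n.
Proof.
move=> /andP[l r]; have /andP[l' r'] := string_code_bounds s.
apply/eqP; rewrite eqn_leq -ltnS -[n <= _]ltnS.
rewrite -(ltn_exp2l (size s) _ (isT : 1 < 2)).
rewrite -(ltn_exp2l n _ (isT : 1 < 2)).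
by rewrite (leq_ltn_trans l' r) (leq_ltn_trans l r').
Qed.

(** In binary, [(string_code s).+1] has the entries of [s] as its digits, the
    lowest one first, below a leading digit one. *)
Lemma string_code_bit s k : k < size s ->
  odd ((string_code s).+1 %/ 2 ^ k) = nth false s k.
Proof.
elim: s k => [//|b s IH] [_|k ks] /=.
  by rewrite divn1 /= oddD odd_double; case: b.
have -> : ((string_code s).*2 + b).+2 = (string_code s).+1 * 2 + b by lia.
rewrite expnS divnMA divnMDl// (_ : b %/ 2 = 0) ?addn0 ?IH//.
by case: (b).
Qed.

Lemma unary_prefix_code j q :
  (string_code (nseq j true ++ false :: q)).+2 = 2 ^ j * (2 * string_code q + 3).
Proof.
elim: j => [|j IH] /=; first by rewrite mul1n; lia.
by rewrite expnS -mulnA -IH; lia.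
Qed.

Lemma unary_prefix_index j (q : seq bool) :
  index false (nseq j true ++ false :: q) = j.
Proof. by elim: j => //= j ->. Qed.

(** The position of the first [false] determines [j], hence the length of the
    whole program, and a proper prefix would be shorter. *)
Lemma unary_prefix_free l j j' (q q' : seq bool) :
  size q = l j -> size q' = l j' ->
  prefix (nseq j true ++ false :: q) (nseq j' true ++ false :: q') ->
  nseq j true ++ false :: q = nseq j' true ++ false :: q'.
Proof.
move=> sq sq' /prefixP[t E].
have jj : j = j'.
  by have := congr1 (index false) E;
  rewrite unary_prefix_index -catA cat_cons unary_prefix_index.
have := congr1 size E; rewrite [RHS]size_cat !size_cat /= sq sq' jj.
move=> /eqP; rewrite -[X in X == _]addn0 eqn_add2l eq_sym size_eq0 => /eqP t0.
by rewrite E t0 cats0 jj.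
Qed.

Definition rank (E : nat -> nat -> bool) (j c : nat) : nat :=
  \sum_(0 <= i < c) E j i.

Lemma rankS (E : nat -> nat -> bool) j c : rank E j c.+1 = rank E j c + E j c.
Proof. exact: big_nat_recr. Qed.

Lemma rank_inj (E : nat -> nat -> bool) j c c' :
  E j c -> E j c' -> rank E j c = rank E j c' -> c = c'.
Proof.
have lt_rank a b : E j a -> a < b -> rank E j a < rank E j b.
  move=> Ea ab; rewrite /rank (@big_cat_nat _ _ _ a.+1 0 b)//=.
  by rewrite -[X in _ < X + _]/(rank E j a.+1) rankS Ea addn1 leq_addr.
move=> Ec Ec' rr; case: (ltngtP c c') => // lt.
  by have := lt_rank _ _ Ec lt; rewrite rr ltnn.
by have := lt_rank _ _ Ec' lt; rewrite rr ltnn.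
Qed.

Lemma rank_count (E : nat -> nat -> bool) j c : rank E j c = count (E j) (iota 0 c).
Proof.
rewrite /rank /index_iota subn0 -sum1_count [RHS]big_mkcond.
by apply: eq_bigr => i _; case: (E j i).
Qed.

(** By [unary_prefix_code], the equation says that [y] is the code of a program
    made of [j] ones, a zero, and the rank of [c] written with [l j] bits: adding
    [2 ^ l j] to the rank supplies the leading digit one. *)
Definition program_code (E : nat -> nat -> bool) (l : nat -> nat) (j c y : nat) :
  bool := E j c && (y.+2 == 2 ^ j * (2 * (2 ^ l j + rank E j c) + 1)).

Lemma program_code_shape (E : nat -> nat -> bool) l j c p : rank E j c < 2 ^ l j ->
  program_code E l j c (string_code p) ->
  exists2 q, size q = l j & p = nseq j true ++ false :: q.
Proof.
move=> rl /andP[_ /eqP pE].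
have l0 : 0 < 2 ^ l j by rewrite expn_gt0.
have [q qE] := string_code_surj (2 ^ l j + rank E j c).-1; exists q.
  by apply: string_code_size; rewrite qE expnS; lia.
apply: string_code_inj; apply: succn_inj; apply: succn_inj.
by rewrite pE unary_prefix_code qE; congr (_ * _); lia.
Qed.

Lemma program_code_unique (E : nat -> nat -> bool) l j j' c c' y :
  (forall j c, E j c -> rank E j c < 2 ^ l j) ->
  program_code E l j c y -> program_code E l j' c' y -> c = c'.
Proof.
move=> El; have [p <-] := string_code_surj y => cp cp'.
have /andP[Ec /eqP pE] := cp; have /andP[Ec' /eqP pE'] := cp'.
have [q _ pq] := program_code_shape (El _ _ Ec) cp.
have [q' _ pq'] := program_code_shape (El _ _ Ec') cp'.
have jj : j = j'.
  by have := congr1 (index false) pq; rewrite pq' !unary_prefix_index.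
move: pE; rewrite pE' -jj in Ec' * => /eqP.
rewrite eqn_pmul2l ?expn_gt0// eqn_add2r eqn_pmul2l// eqn_add2l => /eqP rr.
exact: rank_inj Ec Ec' (esym rr).
Qed.

(** The search for [j] can be bounded by [y] since a program with code [y] and
    [j] leading ones satisfies [j <= y]. *)
Definition decodes (E : nat -> nat -> bool) (l : nat -> nat) (c y : nat) : nat :=
  \sum_(0 <= j < y.+1) program_code E l j c y.

Lemma decodesP (E : nat -> nat -> bool) l c y :
  0 < decodes E l c y <-> exists j, program_code E l j c y.
Proof.
rewrite lt0n sum_nat_seq_neq0; split => [/hasP[j _ /andP[_]]|[j cj]].
  by rewrite eqb0 negbK; exists j.
apply/hasP; exists j; last by rewrite /= cj.
rewrite mem_index_iota /= ltnS.
have /andP[_ /eqP] := cj; have : j < 2 ^ j by rewrite ltn_expl.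
have : 0 < 2 ^ l j by rewrite expn_gt0.
move: (2 ^ l j) (rank E j c) (2 ^ j) => a b d; nia.
Qed.

(** When [E j] has at most [2 ^ l j] elements, a rank in it fits in [l j] bits.
    The machine searches for the string with the given rank, by unbounded
    minimization; a program has at most one output since ranks are injective on
    each [E j]. *)
Lemma enumerative_coding (E : nat -> nat -> bool) (l : nat -> nat) :
  computable2 (fun j c => E j c) -> computable1 l ->
  (forall j c, E j c -> rank E j c < 2 ^ l j) ->
  exists2 M, prefix_free_machine M & forall j s, E j (string_code s) ->
    exists2 p, M p s & size p = j + (l j).+1.
Proof.
move=> cE cl El.
have cT : computable2 (fun c y => 1 - decodes E l c y).
  pose Ef j c : nat := E j c; rewrite -/Ef in cE.
  apply: computable2P; apply: (@eq_computable_fun _ (fun v => 1 -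
    \sum_(0 <= j < (nth 0 v 1).+1) Ef j (nth 0 v 0) * ((nth 0 v 1).+2 ==
      2 ^ j * (2 * (2 ^ l j + \sum_(0 <= i < nth 0 v 0) Ef j i) + 1)))).
    by move=> v _; congr (1 - _); apply: eq_bigr => j _; rewrite mulnb.
  by computability.
have pF := pr_mu cT; set F := pmu _ in pF.
pose M p s := F [tuple string_code p] (string_code s).
have MP p s : M p s <-> exists j, program_code E l j (string_code s) (string_code p).
  rewrite -decodesP /M /F /pmu /= !theadE.
  have -> z : thead (behead_tuple [tuple of z :: [tuple string_code p]]) =
    string_code p by [].
  split => [[]|T0]; first by case: decodes.
  split; first by case: decodes T0.
  move=> i ic; exists 0; rewrite !theadE; case E0 : decodes => [//|n].
  have /decodesP[j cj] : 0 < decodes E l i (string_code p) by rewrite E0.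
  have /decodesP[j' cj'] := T0.
  by move: ic; rewrite (program_code_unique El cj cj') ltnn.
exists M.
  split; first by exists F.
  move=> p q s s' /MP[j cj] /MP[j' cj'].
  have /andP[Es _] := cj; have /andP[Es' _] := cj'.
  have [r sr ->] := program_code_shape (El _ _ Es) cj.
  have [r' sr' ->] := program_code_shape (El _ _ Es') cj'.
  exact: (unary_prefix_free sr sr').
move=> j s Es; have rl := El _ _ Es.
have [q qE] := string_code_surj (2 ^ l j + rank E j (string_code s)).-1.
have l0 : 0 < 2 ^ l j by rewrite expn_gt0.
have cp : program_code E l j (string_code s)
    (string_code (nseq j true ++ false :: q)).
  by rewrite /program_code Es unary_prefix_code qE; apply/eqP; congr (_ * _); lia.
exists (nseq j true ++ false :: q); first by apply/MP; exists j.
have [q' sq' ->] := program_code_shape rl cp.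
by rewrite size_cat size_nseq/= sq'.
Qed.

End Strings.

(** * A maximal inequality for random signs *)

Definition sign_of (R : pzRingType) (b : bool) : R := if b then 1 else -1.

Fixpoint words (n : nat) : seq (seq bool) :=
  if n is m.+1 then map (cons true) (words m) ++ map (cons false) (words m)
  else [:: [::]].

Lemma size_words n : size (words n) = (2 ^ n)%N.
Proof. by elim: n => //= n IH; rewrite size_cat !size_map IH addnn expnS mul2n. Qed.

Lemma mem_words s : s \in words (size s).
Proof.
elim: s => //= b s IH; rewrite mem_cat.
by case: b; rewrite (map_f (cons _) IH) ?orbT.
Qed.

Definition signed_sum (R : pzRingType) (d : nat -> R) (s : seq bool) (m : nat) : R :=
  \sum_(0 <= k < m) sign_of R (nth false s k) * d k.

Definition exceeds (R : realType) (lam a : R) (d : nat -> R) (n : nat)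
    (s : seq bool) : bool :=
  has (fun m => lam <= `|a + signed_sum d s m|) (iota 0 n.+1).

Lemma exceeds_cons (R : realType) (lam a : R) d n b s :
  exceeds lam a d n.+1 (b :: s) =
  (lam <= `|a|) || exceeds lam (a + sign_of R b * d 0%N) (fun k => d k.+1) n s.
Proof.
rewrite /exceeds (_ : iota 0 n.+2 = 0%N :: map S (iota 0 n.+1)); last first.
  by rewrite -(eq_map (f := addn 1)) => [|i]; rewrite ?add1n// -iotaDl.
rewrite -(cat1s 0%N) has_cat has_seq1 has_map {1}/signed_sum big_nil addr0.
congr (_ || _).
apply: eq_has => m /=; rewrite -addrA; congr (_ <= `|_ + _|).
by rewrite /signed_sum big_nat_recl.
Qed.

(** Kolmogorov's inequality, started at [a]. If [`|a|] is already at least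
    [lam], the bound is trivial; otherwise the first sign moves the walk to
    [a + d 0] or [a - d 0], and the mean of the two squares is
    [a ^+ 2 + d 0 ^+ 2]. *)
Lemma kolmogorov_inequality (R : realType) (lam a : R) (d : nat -> R) n :
  0 <= lam ->
  (count (exceeds lam a d n) (words n))%:R * lam ^+ 2 <=
  2 ^+ n * (a ^+ 2 + \sum_(0 <= k < n) d k ^+ 2).
Proof.
move=> lam0; elim: n a d => [|n IH] a d.
  rewrite big_nil addr0 mul1r /= /exceeds /= /signed_sum big_nil addr0 orbF addn0.
  case: (leP lam `|a|) => [la|_]; last by rewrite mul0r sqr_ge0.
  by rewrite mul1r -[a ^+ 2]real_normK ?num_real// lerXn2r ?nnegrE.
have [la|la] := leP lam `|a|.
  rewrite (@le_trans _ _ (2 ^+ n.+1 * lam ^+ 2))//.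
    rewrite ler_wpM2r ?sqr_ge0// -natrX ler_nat -size_words; exact: count_size.
  rewrite ler_wpM2l ?exprn_ge0// -[leLHS]addr0 lerD//.
    by rewrite -[a ^+ 2]real_normK ?num_real// lerXn2r ?nnegrE.
  by rewrite sumr_ge0// => i _; exact: sqr_ge0.
rewrite /= count_cat !count_map.
rewrite (eq_count (a2 := exceeds lam (a + d 0%N) (fun k => d k.+1) n)); last first.
  by move=> s; rewrite /= exceeds_cons leNgt la/= mul1r.
rewrite [X in (_ + X)%:R](eq_count
  (a2 := exceeds lam (a - d 0%N) (fun k => d k.+1) n)); last first.
  by move=> s; rewrite /= exceeds_cons leNgt la/= mulN1r.
rewrite natrD mulrDl (le_trans (lerD (IH _ _) (IH _ _)))//.
rewrite big_nat_recl//= (exprS 2) le_eqVlt; apply/orP; left; apply/eqP; ring.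
Qed.
(** * Exceptional strings *)

(** The walk that starts at time [n] and makes at time [k] the step
    [(p k - m k) / 2 ^ k], with sign given by the [k]th entry of the string with
    code [c], is at time [i] at
    [(walk_part p m n i c - walk_part m p n i c) / 2 ^ i]; see [walk_partE]. *)
Definition walk_part (p m : nat -> nat) (n i c : nat) : nat :=
  \sum_(0 <= k < i) (n <= k) * (2 ^ (i - k) *
    (odd (c.+1 %/ 2 ^ k) * p k + (1 - odd (c.+1 %/ 2 ^ k)) * m k)).

Definition large_at (p m : nat -> nat) (n j c i : nat) : bool :=
  (2 ^ i <= 2 ^ j * (walk_part p m n i c - walk_part m p n i c +
    (walk_part m p n i c - walk_part p m n i c)))%N.

(** The codes of the strings of length [n j.+1] along which the walk that starts
    at time [n j] gets as far as [2 ^- j] from the origin. *)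
Definition exceptional (p m n : nat -> nat) (j c : nat) : bool :=
  [&& 2 ^ n j.+1 <= c.+1, c.+1 < 2 ^ (n j.+1).+1 &
    has (large_at p m (n j) j c) (iota 0 (n j.+1).+1)]%N.

Lemma computable_exceptional p m n :
  computable1 p -> computable1 m -> computable1 n ->
  computable2 (fun j c => exceptional p m n j c).
Proof.
move=> cp cm cn.
apply: computable2P; apply: (@eq_computable_fun _ (fun v =>
  (2 ^ n (nth 0 v 0).+1 <= (nth 0 v 1).+1) *
  ((nth 0 v 1).+2 <= 2 ^ (n (nth 0 v 0).+1).+1) *
  (1 <= \sum_(0 <= i < (n (nth 0 v 0).+1).+1)
    large_at p m (n (nth 0 v 0)) (nth 0 v 0) (nth 0 v 1) i)))%N; last first.
  by rewrite /large_at /walk_part; computability.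
move=> v _; rewrite /exceptional !mulnb -andbA; congr (nat_of_bool [&& _, _ & _]).
rewrite lt0n sum_nat_seq_neq0 /index_iota subn0.
by apply: eq_has => i /=; rewrite eqb0 negbK.
Qed.

Definition block_step (R : realType) (p m : nat -> nat) (n k : nat) : R :=
  if (n <= k)%N then ((p k)%:R - (m k)%:R) / 2 ^+ k else 0.

Lemma walk_partE (R : realType) p m n i s : (i <= size s)%N ->
  (walk_part p m n i (string_code s))%:R - (walk_part m p n i (string_code s))%:R
  = 2 ^+ i * signed_sum (block_step R p m n) s i.
Proof.
move=> si; rewrite !natr_sum -sumrB mulr_sumr; apply: eq_big_nat => k /andP[_ ki].
rewrite string_code_bit ?(leq_trans ki)// /block_step.
case: leqP => nk; last by rewrite !mul0n subr0 !mulr0.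
rewrite -[in (2 ^+ i)](subnK (ltnW ki)) exprD !mul1n !natrM !natrX !natrD !natrM.
have k0 : 2 ^+ k != 0 :> R by rewrite expf_neq0.
by case: nth => /=; rewrite ?subn0 ?subnn ?mul0r ?mul1r; field.
Qed.

Lemma large_atE (R : realType) p m n j s i : (i <= size s)%N ->
  large_at p m n j (string_code s) i =
  (2 ^- j <= `|0 + signed_sum (block_step R p m n) s i|).
Proof.
move=> si; have := walk_partE R p m n si; rewrite /large_at add0r.
set a := walk_part _ _ _ _ _; set b := walk_part _ _ _ _ _ => E.
have absE : ((a - b + (b - a))%N)%:R = `|a%:R - b%:R| :> R.
  case: (leqP a b) => [ab|/ltnW ab].
    rewrite (eqP ab) add0n natrB// distrC ger0_norm// subr_ge0 ler_nat//.
  by rewrite (eqP ab) addn0 natrB// ger0_norm// subr_ge0 ler_nat.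
rewrite -(ler_nat R) natrM !natrX absE E normrM ger0_norm ?exprn_ge0//.
rewrite mulrCA -[X in X <= _]mulr1 ler_pM2l ?exprn_gt0//.
by rewrite -[in RHS]div1r ler_pdivrMr ?exprn_gt0// mulrC.
Qed.

Lemma exceptionalE (R : realType) p m n j s :
  exceptional p m n j (string_code s) =
  (size s == n j.+1) &&
  exceeds (2 ^- j) 0 (block_step R p m (n j)) (n j.+1) s.
Proof.
rewrite /exceptional andbA; have [sn|/eqP sn] := eqVneq (size s) (n j.+1).
  have := string_code_bounds s; rewrite -sn => ->; apply: eq_in_has => i.
  by rewrite mem_iota ltnS => /andP[_ si]; exact: large_atE.
by apply/negbTE; rewrite negb_and; apply/orP; left; apply/negP => /string_code_size.
Qed.

(** By Kolmogorov's inequality, the number of exceptional strings is at most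
    [2 ^ n j.+1 * 2 ^- (5 * j) / (2 ^- j) ^+ 2 = 2 ^ (n j.+1 - 3 * j)]. *)
Lemma rank_exceptional (R : realType) p m n j c :
  \sum_(0 <= k < n j.+1) block_step R p m (n j) k ^+ 2 <= 2 ^- (5 * j) ->
  (3 * j <= n j.+1)%N -> exceptional p m n j c ->
  (rank (exceptional p m n) j c < 2 ^ (n j.+1 - 3 * j))%N.
Proof.
move=> tail jn Ec.
pose bad := exceeds (2 ^- j) 0 (block_step R p m (n j)) (n j.+1).
have : (rank (exceptional p m n) j c < count bad (words (n j.+1)))%N.
  apply: (@leq_trans (rank (exceptional p m n) j c.+1)).
    by rewrite rankS Ec addn1.
  rewrite rank_count -!size_filter -(size_map string_code).
  apply: uniq_leq_size; first by rewrite filter_uniq// iota_uniq.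
  move=> i; rewrite mem_filter => /andP[+ _].
  have [s <-] := string_code_surj i; rewrite (exceptionalE R) => /andP[/eqP sn bs].
  by apply: map_f; rewrite mem_filter [bad _]bs -sn mem_words.
move=> /leq_trans; apply; rewrite -(ler_nat R).
have := kolmogorov_inequality 0 (block_step R p m (n j)) (n j.+1)
  (_ : 0 <= 2 ^- j :> R).
rewrite -/bad expr0n /= add0r => /(_ ltac:(by rewrite invr_ge0 exprn_ge0)) H.
rewrite -(@ler_pM2r _ ((2 ^- j) ^+ 2)) ?exprn_gt0 ?invr_gt0 ?exprn_gt0//.
rewrite (le_trans H)// (le_trans (ler_wpM2l _ tail)) ?exprn_ge0//.
rewrite natrX -!exprVn -exprM le_eqVlt; apply/orP; left; apply/eqP.
rewrite -[in LHS](subnK jn) exprD -mulrA; congr (_ * _).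
rewrite (_ : 5 * j = 3 * j + j * 2)%N; last by lia.
by rewrite exprD mulrA -exprMn mulfV ?expr1n ?mul1r.
Qed.

(** * Incompressible sequences *)

Lemma K_le U q s : U q s -> (K U s <= size q)%N.
Proof.
move=> Uqs; have hq : has_program U s (size q) by apply/asboolP; exists q.
rewrite /K; case: pselect => [ex|[]]; last by exists (size q).
by case: ex_minnP => n _; apply.
Qed.

(** A member of [E j] would have complexity at most [n j - 2 * j] up to an
    additive constant. *)
Lemma KC_not_exceptional U alpha (E : nat -> nat -> bool) (n : nat -> nat) :
  optimal_machine U -> KC U alpha ->
  computable2 (fun j c => E j c) -> computable1 n ->
  (forall j, 3 * j <= n j)%N ->
  (forall j c, E j c -> rank E j c < 2 ^ (n j - 3 * j))%N ->
  exists J, forall j, (J <= j)%N -> ~~ E j (string_code (mkseq alpha (n j))).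
Proof.
move=> [_ Uopt] [k Kk] cE cn nj El.
have cl : computable1 (fun j => n j - 3 * j)%N.
  by apply: computable1P; computability.
have [M Mpf Mp] := enumerative_coding cE cl El.
have [c Uc] := Uopt M Mpf; exists (k + c + 2)%N => j Jj.
apply/negP => /Mp[p /Uc[q /K_le Kq qp] sp].
by have := Kk (n j); have := nj j; lia.
Qed.

(** After time [n j] the oscillation is at most the sum of the [2 ^- i] with
    [j <= i], that is, [2 * 2 ^- j]. *)
Lemma cvgn_of_blocks (R : realType) (b : nat -> R) (n : nat -> nat) (J : nat) :
  (forall j, j <= n j)%N -> {homo n : i j / (i <= j)%N} ->
  (forall j i, (J <= j)%N -> (n j <= i <= n j.+1)%N ->
    `|\sum_(n j <= k < i) b k| <= 2 ^- j) ->
  cvgn (series b).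
Proof.
move=> nj nmono H.
have chain t j i : (J <= j)%N -> (n j <= i <= n (j + t))%N ->
    `|series b i - series b (n j)| <= 2 * (2 ^- j - 2 ^- (j + t)).
  elim: t j => [|t IH] j Jj /andP[ji it].
    move: it; rewrite addn0 => it; rewrite (_ : i = n j) ?subrr ?normr0 ?mulr0//.
    by apply/eqP; rewrite eqn_leq it ji.
  have e1 := expr2V_S R j; have e2 := expr2V_S R (j + t).
  have e3 : 2 ^- (j + t) <= 2 ^- j :> R.
    by rewrite lef_pV2 ?posrE ?exprn_gt0// ler_weXn2l ?ler1n// leq_addr.
  rewrite addnS; have [ij|/ltnW ij] := leqP i (n j.+1).
    rewrite sub_series_geq//; move: (H j i Jj); rewrite ji ij => /(_ isT); lra.
  have := IH j.+1 (leqW Jj); rewrite ij addSnnS => /(_ it).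
  have := H j (n j.+1) Jj; rewrite leqnn nmono// => /(_ isT).
  rewrite -sub_series_geq ?nmono// -[X in `|X| <= 2 * (2 ^- j - _)](subrKA (series b (n j.+1))).
  have := ler_normD (series b i - series b (n j.+1)) (series b (n j.+1) - series b (n j)).
  rewrite addnS; lra.
apply: cauchy_cvg; apply: cauchy_exP => e e0.
pose j := maxn J (Num.bound (2 / e)).
have je : 2 * 2 ^- j < e.
  rewrite ltr_pdivrMr ?exprn_gt0// mulrC -ltr_pdivrMr//.
  rewrite (@lt_trans _ _ (Num.bound (2 / e))%:R)//.
    by rewrite archi_boundP// divr_ge0// ltW.
  by rewrite -natrX ltr_nat (leq_ltn_trans (leq_maxr J _))// ltn_expl.
exists (series b (n j)); exists (n j) => // i /= ji.
rewrite /ball /= distrC (le_lt_trans _ je)// (le_trans (chain i j i _ _))//.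
- exact: leq_maxl.
- by rewrite ji/= (leq_trans (leq_addl j i)).
- by rewrite ler_wpM2l// gerBl invr_ge0 exprn_ge0.
Qed.

Lemma cvgn_series_approx (R : realType) (a b : nat -> R) :
  (forall n, `|a n - b n| <= 2 * 2 ^- n) -> cvgn (series b) -> cvgn (series a).
Proof.
move=> ab cb; have -> : a = b + (a - b).
  by apply/funext => n; rewrite !fctE addrC subrK.
apply: is_cvg_seriesD => //; apply: normed_cvg.
apply: (@series_le_cvg _ _ (geometric 2 2^-1)) => [n|n|n|].
- exact: normr_ge0.
- by rewrite /= mulr_ge0// exprn_ge0// invr_ge0.
- by rewrite /= exprVn; exact: ab.
- by apply: is_cvg_geometric_series; rewrite ger0_norm ?invr_ge0// invf_lt1// ltr1n.
Qed.

(** Since [`|a k - b k| <= 2 * 2 ^- k], one has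
    [b k ^+ 2 <= 2 * a k ^+ 2 + 8 * 4 ^- k], and the last terms add up to less
    than [16 * 4 ^- n] from [n] on. *)
Lemma sum_sqr_approx (R : realType) (a b : nat -> R) n i :
  (forall k, `|a k - b k| <= 2 * 2 ^- k) -> (n <= i)%N ->
  \sum_(n <= k < i) b k ^+ 2 <=
  2 * \sum_(n <= k < i) a k ^+ 2 + 16 * (2 ^- n) ^+ 2.
Proof.
move=> ab ni; have pos k : 0 <= 2 ^- k :> R by rewrite invr_ge0 exprn_ge0.
suff H t : \sum_(n <= k < n + t) b k ^+ 2 <=
    2 * \sum_(n <= k < n + t) a k ^+ 2 +
    16 * ((2 ^- n) ^+ 2 - (2 ^- (n + t)) ^+ 2).
  have := H (i - n)%N; rewrite subnKC//; have := sqr_ge0 (2 ^- i : R); lra.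
elim: t => [|t IH]; first by rewrite addn0 subrr !big_geq// !mulr0 addr0.
rewrite addnS !big_nat_recr ?leq_addr//=.
have -> : 2 ^- (n + t).+1 = 2 ^- (n + t) / 2 :> R.
  by rewrite exprS; field; rewrite expf_neq0.
have : (a (n + t)%N - b (n + t)%N) ^+ 2 <= (2 * 2 ^- (n + t)) ^+ 2.
  by rewrite -[leLHS]real_normK ?num_real// lerXn2r ?nnegrE ?mulr_ge0.
have := sqr_ge0 (2 * a (n + t)%N - b (n + t)%N).
have := sqr_ge0 (2 ^- (n + t) : R).
move: IH; nra.
Qed.

Lemma square_tail (R : realType) (x : nat -> R) (e : R) N n i :
  cvgn (series (fun k => x k ^+ 2)) ->
  `|limn (series (fun k => x k ^+ 2)) - \sum_(0 <= k < N) x k ^+ 2| < e ->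
  (N <= n)%N -> (n <= i)%N -> \sum_(n <= k < i) x k ^+ 2 <= e.
Proof.
move=> cx xe Nn ni.
have mono : nondecreasing_seq (series (fun k => x k ^+ 2)).
  by apply: nondecreasing_series => k _ _; exact: sqr_ge0.
rewrite -sub_series_geq// (@le_trans _ _ (limn (series (fun k => x k ^+ 2))
  - series (fun k => x k ^+ 2) N))//.
  by apply: lerB; [exact: nondecreasing_cvgn_le|exact: mono].
exact: ltW (le_lt_trans (ler_norm _) xe).
Qed.

(** Summing up to [j] makes the times increasing.  The argument
    [2 ^ (5 * i + 2)] of the modulus makes twice the tail of the squares at most
    [2 ^- (5 * j) / 2], and the summand [6] makes the rounding errors at most as
    large. *)
Definition block_end (N : nat -> nat) (j : nat) : nat :=
  \sum_(0 <= i < j.+1) (N (2 ^ (5 * i + 2)) + 6).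

Lemma block_end_ge N j : (N (2 ^ (5 * j + 2)) + 6 * j.+1 <= block_end N j)%N.
Proof.
have ge i : (6 * i <= \sum_(0 <= k < i) (N (2 ^ (5 * k + 2)) + 6))%N.
  by elim: i => // i IH; rewrite big_nat_recr//= mulnS addnC leq_add// leq_addl.
by rewrite /block_end big_nat_recr//=; have := ge j; lia.
Qed.

Lemma block_end_homo N : {homo block_end N : i j / (i <= j)%N}.
Proof.
move=> i j ij; rewrite /block_end (@big_cat_nat _ _ _ i.+1 0 j.+1)//=.
exact: leq_addr.
Qed.

Lemma signed_sum_block (R : realType) p m n alpha L i :
  (n <= i <= L)%N ->
  signed_sum (block_step R p m n) (mkseq alpha L) i =
  \sum_(n <= k < i) epsilon R k alpha * (((p k)%:R - (m k)%:R) / 2 ^+ k).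
Proof.
move=> /andP[ni iL]; rewrite /signed_sum (@big_cat_nat _ _ _ n 0 i)//=.
rewrite [X in X + _ = _]big_nat big1 ?add0r => [|k /andP[_ kn]]; last first.
  by rewrite /block_step leqNgt kn mulr0.
apply: eq_big_nat => k /andP[nk ki].
by rewrite nth_mkseq ?(leq_trans ki)// /block_step nk.
Qed.

Theorem theorem3p2 (R : realType) (U : machine) (hU : optimal_machine U)
  (x phi : nat -> R) (hx : square_computable x) (hphi : computable_seq phi)
  (alpha : nat -> bool) (halpha : KC U alpha)
  (t : R) (ht : 0 <= t <= 1) (htc : computable_real t) :
  cvgn (series (fun n : nat =>
    epsilon R n alpha * x n * cos (2 * pi * n%:R * t + phi n))).
Proof.
have [cx sx [N cN NE]] := hx.
pose a n := x n * cos (2 * pi * n%:R * t + phi n).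
have ca : difference_computable a.
  have c2 : difference_computable (fun=> 2%:R : R).
    by apply: difference_computable_nat; apply: computable1P; computability.
  have cid : difference_computable (fun n => n%:R : R).
    by apply: (difference_computable_nat _ (f := id)); apply: computable1P; computability.
  apply: difference_computable_mul; first exact: computable_seq_difference.
  apply: difference_computable_cos; apply: difference_computable_add.
    do !apply: difference_computable_mul => //.
    - exact: difference_computable_pi.
    - exact: computable_seq_difference.
  exact: computable_seq_difference.
have [p [m [cp cm ab]]] := dyadic_approximation ca.
pose n := block_end N.
have cn : computable1 n.
  by apply: computable1P; rewrite /n /block_end; computability.
have tail j : \sum_(0 <= k < n j.+1) block_step R p m (n j) k ^+ 2 <= 2 ^- (5 * j).
  have nn : (n j <= n j.+1)%N by exact: block_end_homo.
  rewrite (@big_cat_nat _ _ _ (n j))//= [X in X + _]big_nat.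
  rewrite big1 ?add0r => [|k /andP[_ kn]]; last first.
    by rewrite /block_step leqNgt kn expr0n.
  rewrite (eq_big_nat _ _ (F2 := fun k => (((p k)%:R - (m k)%:R) / 2 ^+ k) ^+ 2)); last first.
    by move=> k /andP[nk _]; rewrite /block_step nk.
  rewrite (le_trans (sum_sqr_approx ab nn))//.
  have le_a : \sum_(n j <= k < n j.+1) a k ^+ 2 <=
      \sum_(n j <= k < n j.+1) x k ^+ 2.
    by apply: ler_sum => k _; rewrite /a exprMn ler_piMr ?sqr_ge0//
      cos2sin2 gerBl sqr_ge0.
  have le_x : \sum_(n j <= k < n j.+1) x k ^+ 2 <= (2 ^ (5 * j + 2))%:R^-1.
    have m0 : (0 < 2 ^ (5 * j + 2))%N by rewrite expn_gt0.
    apply: (@square_tail R x _ _ _ _ sx (NE _ m0)) => //.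
    by have := block_end_ge N j; rewrite -/n; lia.
  have le_n : (2 ^- n j) ^+ 2 <= 2 ^- (5 * j + 5) :> R.
    rewrite -exprVn -exprM -exprVn exprVn [leRHS]exprVn.
    rewrite lef_pV2 ?posrE ?exprn_gt0// ler_weXn2l ?ler1n//.
    by have := block_end_ge N j; rewrite -/n; lia.
  move: le_n le_x; rewrite natrX (exprD _ (5 * j) 2) (exprD _ (5 * j) 5) !invfM.
  have : 0 <= 2 ^- (5 * j) :> R by rewrite invr_ge0 exprn_ge0.
  move: le_a; lra.
have n3 j : (3 * j <= n j.+1)%N.
  by have := block_end_ge N j.+1; rewrite -/n; lia.
have cE := computable_exceptional cp cm cn.
have [J HJ] := KC_not_exceptional (n := fun j => n j.+1) hU halpha cE
  (ltac:(by apply: computable1P; computability)) n3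
  (fun j c => @rank_exceptional R p m n j c (tail j) (n3 j)).
pose b k := epsilon R k alpha * (((p k)%:R - (m k)%:R) / 2 ^+ k) : R.
have cb : cvgn (series b).
  apply: (@cvgn_of_blocks _ _ n J) => [j||j i Jj /andP[ji ij]].
  - by have := block_end_ge N j; rewrite -/n; lia.
  - exact: block_end_homo.
  have := HJ j Jj; rewrite (exceptionalE R) size_mkseq eqxx /= => /hasPn.
  move=> /(_ i); rewrite mem_iota ltnS ij /= -ltNge add0r => /(_ isT)/ltW.
  by rewrite signed_sum_block// ji.
apply: cvgn_series_approx cb => k.
rewrite /b -mulrA -mulrBr normrM -/(a k).
rewrite (_ : `|epsilon R k alpha| = 1) ?mul1r//.
by rewrite /epsilon; case: (alpha k); rewrite ?normrN1 ?normr1.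
Qed.
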